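(* Let $X\in\mathcal{D}$, with quantile function $Q$ and quantile density $q$. If $g:(0,1)\to\mathbb{R}$ is a differentiable function such that $g'\cdot Q$ is integrable on $(0,1)$, then $$E[\{g(1)-g(U)\}\,q(U)]=E\left[g'(X^L)\right]E[X],$$ where $U$ is uniformly distributed in $(0,1)$ and $X^L$ is an absolutely continuous random variable with values in $(0,1)$ and density $f_{X^L}(u)=Q(u)/E[X]$, $0<u<1$.
   Context: For a random variable $X$ with distribution function $F(x)=P(X\le x)$, the quantile function is $Q(u)=\inf\{x\in\mathbb{R}:F(x)\ge u\}$, $0<u<1$, and, if $Q$ is differentiable on $(0,1)$, the quantile density is $q(u)=Q'(u)$, $0<u<1$. $\mathcal{D}$ denotes the family of all absolutely continuous random variables with finite mean whose quantile function satisfies $Q(0)=0$ (where $Q(0):=\lim_{u\downarrow 0}Q(u)$) and whose quantile density exists on $(0,1)$; such random variables are nonnegative with finite nonzero mean. The value $g(1)$ means $\lim_{u\uparrow 1}g(u)$. *)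

(* Defs.v *)
From mathcomp Require Import all_boot all_order all_algebra.
From mathcomp Require Import all_classical all_reals all_analysis.
Import Order.TTheory GRing.Theory Num.Theory.
Import numFieldNormedType.Exports.
Set Implicit Arguments.
Unset Strict Implicit.
Unset Printing Implicit Defensive.
Local Open Scope classical_set_scope.
Local Open Scope ring_scope.

(* As a function on R; only its values on ]0, 1[ are meaningful (there the set
   is nonempty and bounded below, so that [inf] is the true infimum). *)
Definition quantile (d : measure_display) (T : measurableType d)
    (R : realType) (P : probability T R) (X : {RV P >-> R}) (u : R) : R :=
  inf [set x : R | (u%:E <= cdf X x)%E].

Definition quantile_density (d : measure_display) (T : measurableType d)
    (R : realType) (P : probability T R) (X : {RV P >-> R}) : R -> R :=
  derive1 (quantile X).

Definition absolutely_continuous (d : measure_display) (T : measurableType d)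
    (R : realType) (P : probability T R) (X : {RV P >-> R}) : Prop :=
  distribution P X `<< lebesgue_measure.

(* The family denoted by a calligraphic D; the third clause is Q(0) = 0, with
   Q(0) the right limit of Q at 0. *)
Definition calD (d : measure_display) (T : measurableType d)
    (R : realType) (P : probability T R) (X : {RV P >-> R}) : Prop :=
  [/\ absolutely_continuous X,
      P.-integrable [set: T] (EFin \o X),
      quantile X u @[u --> 0^'+] --> (0 : R) &
      forall u : R, 0 < u < 1 -> derivable (quantile X) u 1].

Definition has_density (d : measure_display) (T : measurableType d)
    (R : realType) (P : probability T R) (X : {RV P >-> R}) (f : R -> R)
    : Prop :=
  forall A : set R, measurable A ->
    distribution P X A = (\int[lebesgue_measure]_(x in A) (f x)%:E)%E.

Definition uniform01 (d : measure_display) (T : measurableType d)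
    (R : realType) (P : probability T R) (U : {RV P >-> R}) : Prop :=
  forall A : set R, measurable A ->
    distribution P U A = uniform_prob (@ltr01 R) A.

(* The law of X^L: a random variable with values in ]0, 1[ and with density
   Q(u) / E[X] on ]0, 1[ (and 0 elsewhere). *)
Definition lorenz_rv (d d' : measure_display) (T : measurableType d)
    (T' : measurableType d') (R : realType) (P : probability T R)
    (P' : probability T' R) (X : {RV P >-> R}) (XL : {RV P' >-> R}) : Prop :=
  [/\ forall w : T', 0 < XL w < 1,
      absolutely_continuous XL &
      has_density XL ((fun u => quantile X u / fine ('E_P[X])%E) \_ `]0, 1[)].

(* g(1), the left limit of g at 1. *)
Definition at_one (R : realType) (g : R -> R) : R := lim (g u @[u --> 1^'-]).

(* Main.v *)
From HB Require Import structures.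
Require Import Defs.
From mathcomp Require Import all_boot all_order all_algebra.
From mathcomp Require Import all_classical all_reals all_analysis.
From mathcomp Require Import measurable_realfun ring lra.
Import Order.TTheory GRing.Theory Num.Theory.
Import numFieldNormedType.Exports.
Set Implicit Arguments.
Unset Strict Implicit.
Unset Printing Implicit Defensive.
Local Open Scope classical_set_scope.
Local Open Scope ring_scope.

(** Write [Q] for the quantile function, [q] for its derivative, and [m] for
    E[X].  Since [Q(0+) = 0], the fundamental theorem of calculus gives
    [Q v] as the integral of [q] over [u <= v], and [g(1) - g u] as the
    integral of [g'] over [u <= v < 1].  Both sides of the identity are thus
    the double integral of [q u * g' v] over the triangle [0 < u <= v < 1],
    taken in the two possible orders.  As [q >= 0], integrating the absolute
    value over [u] first gives the integral of [|g'| * Q], which is finite by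
    hypothesis, so Fubini's theorem applies ([integral_by_parts_ndecr]).

    [Q] and [g] are only assumed differentiable, with possibly discontinuous
    and unbounded derivatives, so the fundamental theorem is needed in its
    Lebesgue form: if [f] is differentiable at every point of [[a, b]] and [f']
    is integrable, then the integral of [f'] is [f b - f a]
    ([integral_derive1]).  It rests on the one-sided bound that [f b - f a] is
    at most the integral of any [psi >= f'].  For [psi >= 0]
    ([ge0_increment_le_integral]), the level sets of [psi] are enclosed in
    slightly larger open sets; summing the measures of the latter with the
    levels as weights yields a measure whose mass on [[a, b]] is close to the
    integral of [psi], and whose distribution function grows, immediately to
    the right of each point, at least as fast as [f].  A function dominated in
    this sense at every point has the smaller total increment
    ([le_increment_of_right_growth]).  When [f'] is nonnegative, its
    integrability need not be assumed: the reverse bound, for the truncations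
    of [f'], yields it ([ge0_integral_derive1]).

    The expectations become integrals over [(0, 1)] because [U] and [X^L] have
    densities supported there ([expectation_density]); the values of [g]
    outside [(0, 1)] are arbitrary, possibly nonmeasurable, and are discarded
    with a null set.  Finally the density of [X^L] has total mass one, which
    forces [m > 0] and [Q] to be somewhere nonzero; the latter is what makes
    [g'] integrable near [1], hence gives a meaning to [g(1)]. *)

(** * Increments and right growth *)

(** The supremum of the points up to which the inequality holds satisfies it
    too: [f] is continuous and [K] only jumps upwards.  If that supremum were
    less than [b], the growth hypothesis would carry the inequality further to
    the right. *)
Lemma le_increment_of_right_growth (R : realType) (f K : R -> R) (a b : R) :
  a <= b ->
  {in `[a, b], forall x, {for x, continuous f}} ->
  {in `[a, b] &, {homo K : x y / x <= y}} ->
  {in `[a, b[, forall x, exists2 y, x < y <= b & f y - f x <= K y - K x} ->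
  f b - f a <= K b - K a.
Proof.
move=> ab fc Kmono grow.
pose S := [set x | a <= x <= b /\ f x - f a <= K x - K a].
have Sa : S a by rewrite /S/= lexx ab !subrr.
have Sb : ubound S b by move=> x [/andP[]].
have supS : has_sup S by split; [exists a|exists b].
set s := sup S.
have les x : S x -> x <= s by move=> Sx; apply: ub_le_sup => //; exists b.
have as_ : a <= s by exact: les.
have sb : s <= b by apply: ge_sup => //; exists a.
have sab : s \in `[a, b] by rewrite in_itv/= as_.
have Ss : S s.
  split; first by rewrite as_.
  rewrite leNgt; apply/negP => fs.
  have fnear : \forall y \near s, K s - K a + f a < f y.
    by move: (fc s sab) => /cvgr_gt; apply; lra.
  have [e/= e0 he] := fnear.
  have [x Sx sex] := sup_adherent e0 supS.
  have xs : x <= s by exact: les.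
  have fx : K s - K a + f a < f x.
    apply: he; rewrite /= ger0_norm ?subr_ge0//; rewrite -/s in sex; lra.
  case: Sx => /andP[ax xb] Sx.
  have : K x <= K s by apply: (Kmono x s _ sab xs); rewrite in_itv/= ax.
  lra.
move: (sb); rewrite le_eqVlt => /predU1P[<-|sltb]; first by case: Ss.
have sab' : s \in `[a, b[ by rewrite in_itv/= as_.
have [y /andP[sy yb] fy] := grow s sab'.
have Sy : S y.
  by split; [lra|case: Ss => _; lra].
have := les _ Sy; lra.
Qed.

(** * Increments bounded by integrals *)

Lemma lebesgue_itvcc (R : realType) (a b : R) : a <= b ->
  @lebesgue_measure R `[a, b]%classic = (b - a)%:E.
Proof.
move=> ab; rewrite lebesgue_measure_itv/= lte_fin; case: ltP => // ba.
by have -> : b = a; [lra|rewrite subrr].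
Qed.

Lemma derivable_right_slope (R : realType) (f : R -> R) (x c : R) :
  derivable f x 1 -> derive1 f x < c ->
  exists2 d, x < d & forall y, x < y < d -> f y - f x <= c * (y - x).
Proof.
move=> dfx fc.
have : is_derive x 1 f (derive1 f x) by rewrite derive1E; exact/derivableP.
move=> /is_derive1_caratheodory[h [fh ch hx]].
have : \forall y \near x, h y < c.
  by move: ch => /cvgr_lt; apply; rewrite hx.
move=> [e/= e0 he]; exists (x + e); first by rewrite ltrDl.
move=> y /andP[xy yd]; rewrite fh ler_wpM2r//; first by lra.
by apply/ltW/he => /=; rewrite ltr0_norm; lra.
Qed.

(** [psi] lies between [n * eps] and [c n = (n + 1) * eps] on its level set
    [A n].  An open [W n] containing [A n] contains an interval to the right of
    each of its points, along which the measure [kappa], the sum of the [c n]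
    times the Lebesgue measure on [W n], grows at rate at least
    [c n > psi >= f'].  The excess of [kappa] over the integral of [psi] comes
    from the rounding of the levels and from the sets [W n `\` A n]. *)
Lemma ge0_increment_le_integral (R : realType) (f psi : R -> R) (a b : R) :
  a <= b ->
  {in `[a, b], forall x, derivable f x 1} ->
  measurable_fun `[a, b] psi ->
  {in `[a, b], forall x, 0 <= psi x} ->
  {in `[a, b], forall x, derive1 f x <= psi x} ->
  ((f b - f a)%:E <= \int[lebesgue_measure]_(x in `[a, b]) (psi x)%:E)%E.
Proof.
move=> ab df mpsi psi0 fpsi.
set mu := lebesgue_measure.
have muab : mu `[a, b]%classic = (b - a)%:E by exact: lebesgue_itvcc.
set I := (\int[mu]_(x in _) _)%E.
have [->|Ifin] := eqVneq I +oo%E; first by rewrite leey.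
apply/lee_addgt0Pr => e e0.
(* [eps * (b - a)] is lost in rounding the levels up, and [eps] in enlarging
   the level sets. *)
pose eps := e / (b - a + 1).
have eps0 : 0 < eps by rewrite divr_gt0//; lra.
have epsE : eps * (b - a + 1) = e by rewrite /eps divfK//; lra.
clearbody eps.
pose c (n : nat) := n.+1%:R * eps.
have c0 n : 0 < c n by rewrite mulr_gt0.
pose A n := `[a, b] `&` psi @^-1` `[n%:R * eps, n.+1%:R * eps[.
have mA n : measurable (A n) by exact: mpsi.
have Aab n : A n `<=` `[a, b] by exact: subIsetl.
have bigA : \bigcup_n A n = `[a, b]%classic.
  apply/seteqP; split=> [x [n _ []]//|x xab].
  have p0 : 0 <= psi x / eps by rewrite divr_ge0 ?psi0// ltW.
  exists (Num.truncn (psi x / eps)) => //; split => //=.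
  rewrite in_itv/= -ler_pdivlMr// -ltr_pdivrMr//.
  exact: truncn_itv.
have trivA : trivIset setT A.
  apply/trivIsetP => i j _ _ ij; apply/seteqP; split=> // x [[_ xi] [_ xj]].
  move: xi xj; rewrite /= !in_itv/= -!ler_pdivlMr// -!ltr_pdivrMr// => xi xj.
  by move: ij; rewrite -(truncn_def xi) -(truncn_def xj) eqxx.
have muA n : (mu (A n) < +oo)%E.
  apply: (@le_lt_trans _ _ (mu `[a, b]%classic)); last by rewrite muab ltry.
  by apply: le_measure; rewrite ?inE//; exact: mA.
have /choice[W HW] : forall n, exists W, [/\ open W, A n `<=` W &
    (mu (W `\` A n) < (eps / 2 ^+ n.+1 / c n)%:E)%E].
  move=> n; apply: lebesgue_regularity_outer => //.
  by rewrite (divr_gt0 (divr_gt0 eps0 _))// exprn_gt0.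
have mW n : measurable (W n) by have [oW _ _] := HW n; exact: open_measurable.
pose kappa := mseries (fun n => mscale (NngNum (ltW (c0 n))) (mrestr mu (mW n))) 0.
have kappaE B : kappa B = (\sum_(n <oo) (c n)%:E * mu (B `&` W n))%E by [].
have muW n : ((c n)%:E * mu (`[a, b] `&` W n) <=
    (c n)%:E * mu (A n) + (eps / (2 ^ n.+1)%:R)%:E)%E.
  have [_ AW WA] := HW n.
  have -> : (eps / (2 ^ n.+1)%:R)%:E = ((c n)%:E * (eps / 2 ^+ n.+1 / c n)%:E)%E.
    by rewrite -EFinM natrX [c n * _]mulrC divfK// gt_eqF.
  have q0 : 0 <= eps / 2 ^+ n.+1 / c n.
    by apply/ltW/(divr_gt0 (divr_gt0 eps0 _)) => //; rewrite exprn_gt0.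
  rewrite -ge0_muleDr ?lee_fin//.
  apply: lee_wpmul2l; first by rewrite lee_fin ltW.
  apply: le_trans (leeD2l _ (ltW WA)).
  have mWA : measurable (W n `\` A n).
    by apply: measurableD; [exact: mW|exact: mA].
  have tAW : A n `&` (W n `\` A n) = set0.
    by rewrite setDE setICA setICr setI0.
  rewrite -(measureU mu (mA n) mWA tAW).
  apply: le_measure; rewrite ?inE.
  - by apply: measurableI => //; exact: mW.
  - by apply: measurableU; [exact: mA|exact: mWA].
  - move=> x [_ Wx]; have [?|?] := pselect (A n x); [by left|by right].
have sumA : (\sum_(n <oo) (c n)%:E * mu (A n) <= I + (eps * (b - a))%:E)%E.
  have -> : (I + (eps * (b - a))%:E =
      \int[mu]_(x in `[a, b]) ((psi x)%:E + eps%:E))%E.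
    rewrite ge0_integralD//.
    - by rewrite integral_cst// EFinM -muab.
    - exact/measurable_EFinP.
    - by move=> x _; rewrite lee_fin ltW.
  rewrite -bigA ge0_integral_bigcup//=; last 2 first.
  - rewrite bigA; apply: emeasurable_funD => //; exact/measurable_EFinP.
  - move=> x; rewrite bigA => xab; rewrite -EFinD lee_fin addr_ge0 ?psi0//.
    exact: ltW.
  apply: lee_nneseries => [n _ _|n _]; first by rewrite mule_ge0// lee_fin ltW.
  rewrite -integral_cst; last exact: mA.
  apply: ge0_le_integral => //; first exact: mA.
  - by move=> x _; rewrite lee_fin ltW.
  - apply/measurable_EFinP/measurable_funD => //.
    exact: measurable_funS mpsi.
  - move=> x [_ /=]; rewrite in_itv/= -EFinD lee_fin => /andP[h _].
    by rewrite /c -natr1 mulrDl mul1r lerD2r.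
have kappaab : (kappa `[a, b]%classic <= I + (eps * (b - a + 1))%:E)%E.
  rewrite kappaE.
  apply: (@le_trans _ _
    (\sum_(n <oo) ((c n)%:E * mu (A n) + (eps / (2 ^ n.+1)%:R)%:E))%E).
    by apply: lee_nneseries => // n _ _; rewrite mule_ge0// lee_fin ltW.
  apply: (le_trans (epsilon_trick _ _ (ltW eps0))).
    by move=> n; rewrite mule_ge0// lee_fin ltW.
  by rewrite mulrDr mulr1 EFinD addeA leeD2r.
have kappa_fin x : x <= b -> kappa `[a, x]%classic \is a fin_num.
  move=> xb; rewrite ge0_fin_numE//.
  have : (kappa `[a, x]%classic <= kappa `[a, b]%classic)%E.
    apply: le_measure; rewrite ?inE//.
    by apply: subset_itvl; rewrite bnd_simp.
  move=> /le_lt_trans; apply; apply: (le_lt_trans kappaab).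
  by rewrite lte_add_pinfty ?ltry// ltey.
have kappaD x y : a <= x -> x <= y ->
    (kappa `[a, y]%classic = kappa `[a, x]%classic + kappa `]x, y]%classic)%E.
  move=> ax xy; rewrite -measureU//.
    by rewrite -itv_bndbnd_setU// bnd_simp.
  apply/seteqP; split=> // z [/=]; rewrite !in_itv/= => /andP[_ zx] /andP[xz _].
  by move: (lt_le_trans xz zx); rewrite ltxx.
pose K x := fine (kappa `[a, x]%classic).
have Kmono : {in `[a, b] &, {homo K : x y / x <= y}}.
  move=> x y; rewrite !in_itv/= => /andP[ax xb] /andP[ay yb] xy.
  rewrite /K fine_le ?kappa_fin//.
  by rewrite (kappaD x y)// leeDl.
have fK : f b - f a <= K b - K a.
  apply: le_increment_of_right_growth => //.
    by move=> x /df/derivable1_diffP/differentiable_continuous.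
  move=> x xab.
  have [ax xb] : a <= x /\ x < b by move: xab; rewrite in_itv/= => /andP.
  have xab' : x \in `[a, b] by rewrite in_itv/= ax ltW.
  have [n _ Anx] : (\bigcup_n A n) x by rewrite bigA.
  have [oW AW _] := HW n.
  have fxc : derive1 f x < c n.
    have [_ /=] := Anx; rewrite in_itv/= => /andP[_].
    exact: (le_lt_trans (fpsi x xab')).
  have [d1 xd1 hd1] := derivable_right_slope (df x xab') fxc.
  have /= := oW _ (AW _ Anx).
  move=> [d2/= d20 hd2].
  pose y := x + Num.min (b - x) (Num.min (d1 - x) d2) / 2.
  have m0 : 0 < Num.min (b - x) (Num.min (d1 - x) d2).
    by rewrite !lt_min !subr_gt0 xb xd1.
  have [m1 m2 m3] : [/\ Num.min (b - x) (Num.min (d1 - x) d2) <= b - x,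
      Num.min (b - x) (Num.min (d1 - x) d2) <= d1 - x &
      Num.min (b - x) (Num.min (d1 - x) d2) <= d2].
    by rewrite !ge_min !lexx !orbT.
  have xy : x < y by rewrite /y; lra.
  have yb : y <= b by rewrite /y; lra.
  exists y; first by rewrite xy.
  have xyW : `]x, y] `<=` W n.
    move=> z /=; rewrite in_itv/= => /andP[xz zy]; apply: hd2 => /=.
    by rewrite ltr0_norm; [rewrite /y in zy; lra|lra].
  have fy : f y - f x <= c n * (y - x).
    by apply: hd1; rewrite xy/= /y; lra.
  rewrite (le_trans fy)//.
  rewrite /K lerBrDl -lee_fin EFinD !fineK ?kappa_fin//; last exact: ltW.
  rewrite (kappaD x y) ?(ltW xy)// leeD2l//.
  have -> : ((c n * (y - x))%:E = (c n)%:E * mu (`]x, y] `&` W n))%E.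
    rewrite (setIidl xyW) /mu lebesgue_measure_itv/= lte_fin xy.
    by rewrite -EFinD EFinM.
  rewrite kappaE (nneseriesD1 (n := n))//; last first.
    by move=> k _; rewrite mule_ge0// lee_fin ltW.
  rewrite leeDl// nneseries_ge0// => k _ _.
  by rewrite mule_ge0// lee_fin ltW.
have Ka : 0 <= K a by rewrite fine_ge0.
apply: (@le_trans _ _ (K b)%:E); first by rewrite lee_fin; lra.
by rewrite -epsE fineK ?kappa_fin.
Qed.

Lemma integrable_bounded_itvcc (R : realType) (f : R -> R) (a b M : R) : a <= b ->
  measurable_fun `[a, b] f -> {in `[a, b], forall x, `|f x| <= M} ->
  (@lebesgue_measure R).-integrable `[a, b] (EFin \o f).
Proof.
move=> ab mf fM; apply: measurable_bounded_integrable => //.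
  by rewrite [ltLHS]lebesgue_itvcc// ltry.
exists M; split; first exact: num_real.
by move=> y My x xab /=; rewrite (le_trans _ (ltW My))// fM.
Qed.

(** Reduction to the nonnegative case: [max psi (- n) + n] is nonnegative and
    dominates the derivative of [f x + n * x], and the terms linear in [n]
    cancel.  Then [n] tends to infinity by dominated convergence. *)
Lemma increment_le_integral (R : realType) (f psi : R -> R) (a b : R) :
  a <= b ->
  {in `[a, b], forall x, derivable f x 1} ->
  (@lebesgue_measure R).-integrable `[a, b] (EFin \o psi) ->
  {in `[a, b], forall x, derive1 f x <= psi x} ->
  ((f b - f a)%:E <= \int[lebesgue_measure]_(x in `[a, b]) (psi x)%:E)%E.
Proof.
move=> ab df ipsi fpsi.
have mpsi : measurable_fun `[a, b] psi.
  by apply/measurable_EFinP; exact: measurable_int ipsi.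
pose psi_ (n : nat) x := Num.max (psi x) (- n%:R).
have mpsi_ n : measurable_fun `[a, b] (psi_ n) by exact: measurable_maxr.
have psi_abs n x : `|psi_ n x| <= `|psi x|.
  rewrite /psi_ maxEle; case: ifPn => // h.
  by rewrite normrN normr_nat ler_normr; apply/orP; right; lra.
have ipsi_ n : (@lebesgue_measure R).-integrable `[a, b] (EFin \o psi_ n).
  apply: le_integrable ipsi => //; first by apply/measurable_EFinP; exact: mpsi_.
  by move=> x _ /=; rewrite lee_fin.
have step n : ((f b - f a)%:E <=
    \int[lebesgue_measure]_(x in `[a, b]) (psi_ n x)%:E)%E.
  pose fn x := f x + n%:R * x.
  have dfn x : x \in `[a, b] -> is_derive x 1 fn (derive1 f x + n%:R).
    move=> /df dfx; rewrite derive1E; apply: is_deriveD.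
      exact/derivableP.
    have : is_derive x 1 (n%:R \*: @id R) (n%:R *: 1) by exact: is_deriveZ.
    by rewrite /GRing.scale/= mulr1.
  have := @ge0_increment_le_integral R fn (fun x => psi_ n x + n%:R) a b ab.
  have -> : (\int[lebesgue_measure]_(x in `[a, b]) (psi_ n x + n%:R)%:E =
     \int[lebesgue_measure]_(x in `[a, b]) (psi_ n x)%:E + (n%:R * (b - a))%:E)%E.
    under eq_integral do rewrite EFinD.
    rewrite integralD//; last 2 first.
      exact: ipsi_.
      apply: (@integrable_bounded_itvcc _ (cst n%:R) _ _ n%:R) => // x _.
      by rewrite /= normr_nat.
    by rewrite integral_cst// [X in (_ * X)%E]lebesgue_itvcc// EFinM.
  have -> : (fn b - fn a)%:E = ((f b - f a)%:E + (n%:R * (b - a))%:E)%E.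
    by rewrite -EFinD /fn; congr EFin; ring.
  rewrite leeD2rE; last by []; apply.
  - by move=> x /dfn[].
  - exact: measurable_funD.
  - by move=> x _; rewrite /psi_ -lerBlDr sub0r le_max lexx orbT.
  - move=> x xab; have [_ dfnE] := dfn x xab.
    by rewrite [leLHS]derive1E dfnE lerD2r /psi_ le_max fpsi.
have cvg_psi_ x : `[a, b]%classic x ->
    (psi_ n x)%:E @[n --> \oo] --> (psi x)%:E.
  move=> _; apply: cvg_near_cst.
  exists (Num.truncn `|psi x|).+1 => // n /= hn; congr EFin.
  apply/max_idPl; rewrite -subr_ge0 opprK.
  have : `|psi x| <= n%:R.
    by rewrite (le_trans (ltW (truncnS_gt _)))// ler_nat.
  by rewrite ler_norml => /andP[+ _]; lra.
have mEpsi_ n : measurable_fun `[a, b] (EFin \o psi_ n).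
  by apply/measurable_EFinP; exact: mpsi_.
have [] := @dominated_convergence _ _ R (@lebesgue_measure R) `[a, b]%classic
  _ (fun n => EFin \o psi_ n) (EFin \o psi) (abse \o (EFin \o psi)) => //.
- exact/measurable_EFinP.
- exact: aeW.
- exact: integrable_abse.
- by apply: aeW => x n _; rewrite /= lee_fin.
move=> _ _ cvg_int.
rewrite -(cvg_lim _ cvg_int)//; apply: lime_ge; last exact: nearW.
by apply/cvg_ex; eexists; exact: cvg_int.
Qed.

Lemma integral_le_increment (R : realType) (f psi : R -> R) (a b : R) :
  a <= b ->
  {in `[a, b], forall x, derivable f x 1} ->
  (@lebesgue_measure R).-integrable `[a, b] (EFin \o psi) ->
  {in `[a, b], forall x, psi x <= derive1 f x} ->
  (\int[lebesgue_measure]_(x in `[a, b]) (psi x)%:E <= (f b - f a)%:E)%E.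
Proof.
move=> ab df ipsi fpsi.
have dNf x : x \in `[a, b] -> is_derive x 1 (- f) (- derive1 f x).
  by move=> /df dfx; rewrite derive1E; apply: is_deriveN; exact/derivableP.
have := @increment_le_integral R (- f) (fun x => - psi x) a b ab.
have -> : (- f) b - (- f) a = - (f b - f a) by rewrite !fctE; ring.
rewrite (EFinN (f b - f a)); under eq_integral do rewrite EFinN.
rewrite integralN//; last exact: integrable_add_def.
rewrite leeN2; apply.
- by move=> x /dNf[].
- exact: integrableN ipsi.
- move=> x xab; have [_ dE] := dNf x xab.
  by rewrite [leLHS]derive1E dE lerN2 fpsi.
Qed.

(** * The fundamental theorem of calculus for differentiable functions *)

Lemma integral_derive1 (R : realType) (f : R -> R) (a b : R) :
  a <= b ->
  {in `[a, b], forall x, derivable f x 1} ->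
  (@lebesgue_measure R).-integrable `[a, b] (EFin \o derive1 f) ->
  (\int[lebesgue_measure]_(x in `[a, b]) (derive1 f x)%:E = (f b - f a)%:E)%E.
Proof.
move=> ab df idf; apply/eqP; rewrite eq_le.
by rewrite integral_le_increment//= increment_le_integral.
Qed.

(** Here integrability is a consequence: the truncations [min f' n] are
    bounded and at most [f'], so their integrals are at most [f b - f a], and
    so is the integral of their monotone limit [f']. *)
Lemma ge0_integral_derive1 (R : realType) (f : R -> R) (a b : R) :
  a <= b ->
  {in `[a, b], forall x, derivable f x 1} ->
  measurable_fun `[a, b] (derive1 f) ->
  {in `[a, b], forall x, 0 <= derive1 f x} ->
  (\int[lebesgue_measure]_(x in `[a, b]) (derive1 f x)%:E = (f b - f a)%:E)%E.
Proof.
move=> ab df mdf df0; apply: integral_derive1 => //.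
pose g (n : nat) x := Num.min (derive1 f x) n%:R.
have g0 n x : x \in `[a, b] -> 0 <= g n x.
  by move=> /df0 ?; rewrite /g le_min; apply/andP; split.
have mg n : measurable_fun `[a, b] (g n) by exact: measurable_minr.
have mEg n : measurable_fun `[a, b] (EFin \o g n).
  by apply/measurable_EFinP; exact: mg.
have ig n : (@lebesgue_measure R).-integrable `[a, b] (EFin \o g n).
  apply: (@integrable_bounded_itvcc _ _ _ _ n%:R) => //.
  by move=> x xab; rewrite ger0_norm; [rewrite /g ge_min lexx orbT|exact: g0].
have intg n : (\int[lebesgue_measure]_(x in `[a, b]) (g n x)%:E <= (f b - f a)%:E)%E.
  apply: integral_le_increment => // x _.
  by rewrite /g ge_min lexx.
apply/integrableP; split; first exact/measurable_EFinP.
under eq_integral => x xab.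
  rewrite /= ger0_norm; last by apply: df0; rewrite inE in xab.
  over.
have <- : (\int[lebesgue_measure]_(x in `[a, b]) limn (fun n => (g n x)%:E) =
    \int[lebesgue_measure]_(x in `[a, b]) (derive1 f x)%:E)%E.
  apply: eq_integral => x; rewrite inE/= => xab.
  apply/cvg_lim => //; apply: cvg_near_cst.
  exists (Num.truncn (derive1 f x)).+1 => // n /= hn; congr EFin.
  by apply/min_idPl; rewrite (le_trans (ltW (truncnS_gt _)))// ler_nat.
have nd x : `[a, b]%classic x ->
    {homo (fun n => (g n x)%:E) : n m / (n <= m)%N >-> (n <= m)%E}.
  move=> _ m n mn; rewrite lee_fin /g le_min ge_min lexx/= ge_min.
  by apply/orP; right; rewrite ler_nat.
have g0' n x : `[a, b]%classic x -> (0 <= (g n x)%:E)%E.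
  move=> xab; rewrite lee_fin; exact: g0.
rewrite (monotone_convergence lebesgue_measure)//.
apply: (@le_lt_trans _ _ (f b - f a)%:E); last exact: ltry.
apply: lime_le; last exact: nearW.
by apply/cvg_ex; eexists; exact: (@cvg_monotone_convergence _ _ R (@lebesgue_measure R)).
Qed.

Lemma derivable_measurable (R : realType) (f : R -> R) (D : set R) : open D ->
  (forall x, D x -> derivable f x 1) -> measurable_fun D f.
Proof.
move=> oD df; apply: open_continuous_measurable_fun => // x; rewrite inE => Dx.
exact/differentiable_continuous/derivable1_diffP/df.
Qed.

(** The difference quotients are those of the restriction of [f] to [D]: the
    points [x + 1 / n] may leave [D], where [f] need not be measurable. *)
Lemma measurable_derive1 (R : realType) (f : R -> R) (D : set R) : open D ->
  (forall x, D x -> derivable f x 1) -> measurable_fun D (derive1 f).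
Proof.
move=> oD df; have mD := open_measurable oD.
have mf : measurable_fun D f by exact: derivable_measurable.
pose F := f \_ D.
have mF : measurable_fun setT F by exact/(measurable_restrictT _ mD).
pose slope n x := n.+1%:R * (F (x + n.+1%:R^-1) - F x).
apply: (@measurable_fun_cvg _ _ _ D slope).
  move=> n; apply: measurable_funTS; apply: measurable_funM => //.
  apply: measurable_funB => //; apply: measurableT_comp => //.
  exact: measurable_funD.
move=> x Dx.
have : is_derive x 1 f (derive1 f x) by rewrite derive1E; exact/derivableP/df.
move=> /is_derive1_caratheodory[h [fh ch <-]].
have cvg_x : x + n.+1%:R^-1 @[n --> \oo] --> x.
  rewrite -[X in _ --> X]addr0; apply: cvgD; first exact: cvg_cst.
  exact: cvg_harmonic.
have : h (x + n.+1%:R^-1) @[n --> \oo] --> h x.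
  exact: (cvg_comp _ _ cvg_x ch).
apply: cvg_trans; apply: near_eq_cvg.
have : \forall n \near \oo, D (x + n.+1%:R^-1).
  by apply: cvg_x; exact: open_nbhs_nbhs.
apply: filterS => n Dn.
by rewrite /slope /F !patchE !mem_set// fh addrAC subrr add0r mulrCA divff// mulr1.
Qed.

Lemma ndecr_derive1_ge0 (R : realType) (f : R -> R) (a b x : R) :
  {in `]a, b[ &, {homo f : y z / y <= z}} -> x \in `]a, b[ ->
  derivable f x 1 -> 0 <= derive1 f x.
Proof.
move=> fmono xab dfx.
have : is_derive x 1 f (derive1 f x) by rewrite derive1E; exact/derivableP.
move=> /is_derive1_caratheodory[h [fh ch <-]].
have [ax xb] : a < x /\ x < b by move: xab; rewrite in_itv/= => /andP.
apply: (cvgr_to_ge (cvg_at_right_filter ch)); near=> z.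
have xz : x < z by near: z; exact: nbhs_right_gt.
have zb : z < b by near: z; exact: nbhs_right_lt.
rewrite -(@pmulr_lge0 _ (z - x)) ?subr_gt0// -fh subr_ge0.
by apply: fmono => //; rewrite ?in_itv/= ?zb ?(lt_trans ax xz)// ltW.
Unshelve. all: by end_near. Qed.

Lemma ndecr_ge_at_right (R : realType) (f : R -> R) (a b l x : R) :
  {in `]a, b[ &, {homo f : y z / y <= z}} -> f y @[y --> a^'+] --> l ->
  x \in `]a, b[ -> l <= f x.
Proof.
move=> fmono fl xab.
have [ax xb] : a < x /\ x < b by move: xab; rewrite in_itv/= => /andP.
apply: (cvgr_to_le fl); near=> y.
have ay : a < y by near: y; exact: nbhs_right_gt.
have yx : y < x by near: y; exact: nbhs_right_lt.
by apply: (fmono _ _ _ xab (ltW yx)); rewrite in_itv/= ay (lt_trans yx).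
Unshelve. all: by end_near. Qed.

(** Exhaust [`]a, b]] by compact intervals; [l] takes the place of [f a]. *)
Lemma ge0_integral_derive1_oc (R : realType) (f : R -> R) (a b l : R) :
  a < b ->
  {in `]a, b], forall x, derivable f x 1} ->
  measurable_fun `]a, b] (derive1 f) ->
  {in `]a, b], forall x, 0 <= derive1 f x} ->
  f x @[x --> a^'+] --> l ->
  (\int[lebesgue_measure]_(x in `]a, b]) (derive1 f x)%:E = (f b - l)%:E)%E.
Proof.
move=> ab df mdf df0 fl.
pose s (n : nat) := a + (b - a) / n.+1%:R.
have sa n : a < s n by rewrite ltrDl divr_gt0// subr_gt0.
have sb n : s n <= b.
  by rewrite -lerBrDl ler_pdivrMr// ler_peMr ?subr_ge0 ?(ltW ab)// ler1n.
have sub n : `[s n, b] `<=` `]a, b].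
  by apply: subset_itvr; rewrite bnd_simp.
have sl : s n @[n --> \oo] --> a.
  rewrite -[X in _ --> X]addr0; apply: cvgD; first exact: cvg_cst.
  rewrite -[X in _ --> X](mulr0 (b - a)); apply: cvgM; first exact: cvg_cst.
  exact: cvg_harmonic.
have bigE : \bigcup_n `[s n, b]%classic = `]a, b]%classic.
  apply/seteqP; split=> [x [n _]|x]; first exact: sub.
  rewrite /= in_itv/= => /andP[ax xb].
  have [n _ /(_ _ (leqnn _)) snx] : \forall n \near \oo, s n < x.
    by move: sl => /cvgr_lt; apply.
  by exists n => //=; rewrite in_itv/= xb ltW.
rewrite -bigE.
have : (\int[lebesgue_measure]_(x in `[s n, b]) (derive1 f x)%:E @[n --> \oo] -->
    \int[lebesgue_measure]_(x in \bigcup_n `[s n, b]%classic) (derive1 f x)%:E)%E.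
  apply: ge0_nondecreasing_set_cvg_integral => //.
  - move=> m n mn; rewrite subsetEset; apply: subset_itvr; rewrite bnd_simp.
    rewrite lerD2l ler_pM2l ?subr_gt0// lef_pV2 ?posrE// ler_nat//.
  - move=> n; apply/measurable_EFinP; exact: measurable_funS (@sub n) mdf.
  - by move=> n x /sub xab; rewrite lee_fin; apply: df0.
move=> /(cvg_unique _); apply => //.
have -> : (fun n => \int[lebesgue_measure]_(x in `[s n, b]) (derive1 f x)%:E)%E
    = (fun n => (f b - f (s n))%:E).
  apply/funext => n; apply: ge0_integral_derive1 => //.
  - by move=> x /sub; exact: df.
  - exact: measurable_funS (@sub n) mdf.
  - by move=> x /sub; exact: df0.
apply: cvg_EFin; first exact: nearW.
apply: cvgB; first exact: cvg_cst.
by move/cvg_at_rightP : fl; apply.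
Qed.

(** An integrable derivative forces a limit at the end of the interval, since
    the integral over [[a, x]] is continuous in [x] up to [b]. *)
Lemma integral_derive1_co (R : realType) (f : R -> R) (a b : R) :
  a < b ->
  {in `[a, b[, forall x, derivable f x 1} ->
  (@lebesgue_measure R).-integrable `[a, b[ (EFin \o derive1 f) ->
  f x @[x --> b^'-] -->
  f a + \int[lebesgue_measure]_(x in `[a, b[) (derive1 f x).
Proof.
move=> ab df idf.
pose F := derive1 f \_ `[a, b[.
have iF : (@lebesgue_measure R).-integrable setT (EFin \o F).
  move/integrable_mkcond : idf => /(_ (measurable_itv _)).
  by congr (integrable _ _ _); apply/funext => x; rewrite /F/= !patchE; case: ifP.
have iFab : (@lebesgue_measure R).-integrable `[a, b] (EFin \o F).
  exact: integrableS iF.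
have := parameterized_integral_cvg_at_left ab iFab.
rewrite /parameterized_integral.
have <- : \int[lebesgue_measure]_(x in `[a, b[) F x =
   \int[lebesgue_measure]_(t in `[a, b]) F t.
  by apply: Rintegral_itv_bndo_bndc; exact: integrableS iF.
have -> : \int[lebesgue_measure]_(x in `[a, b[) F x =
    \int[lebesgue_measure]_(x in `[a, b[) (derive1 f x).
  by apply: eq_Rintegral => x xab; rewrite /F patchE xab.
move=> h; have {}h : f a + \int[lebesgue_measure]_(t in `[a, x]) F t @[x --> b^'-] -->
    f a + \int[lebesgue_measure]_(x in `[a, b[) (derive1 f x).
  by apply: cvgD => //; exact: cvg_cst.
apply: (cvg_trans _ h); apply: near_eq_cvg; near=> x.
have ax : a <= x by near: x; exact: nbhs_left_ge.
have xb : x < b by near: x; exact: nbhs_left_lt.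
have sub : `[a, x] `<=` `[a, b[ by apply: subset_itvl; rewrite bnd_simp.
rewrite /Rintegral [X in _ + fine X](_ : _ = (f x - f a)%:E) /=; last first.
  rewrite -(@integral_derive1 R f a x)//.
  - apply: eq_integral => y; rewrite inE => /sub yab.
    by rewrite /F patchE mem_set.
  - by move=> y /sub; exact: df.
  - exact: integrableS idf.
by rewrite addrC subrK.
Unshelve. all: by end_near. Qed.

(** * Integration by parts against a nondecreasing function *)

(** Both sides are the integral of [derive1 Q u * derive1 g v] over
    [a < u <= v < b].  The increment [l - g u] can be written as an integral
    only where [derive1 g] is integrable on [`[u, b[]; this holds when
    [Q u > 0], because [|derive1 g| <= |derive1 g * Q| / Q u] there.  At a
    point where [Q u = 0] the function [Q] has a minimum, hence
    [derive1 Q u = 0], and [(l - g u) * derive1 Q u] and the integrand of the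
    double integral both vanish. *)
Lemma integral_by_parts_ndecr (R : realType) (Q g : R -> R) (a b : R) :
  {in `]a, b[, forall x, derivable Q x 1} ->
  {in `]a, b[ &, {homo Q : x y / x <= y}} ->
  Q x @[x --> a^'+] --> 0 ->
  (exists2 x, x \in `]a, b[ & Q x != 0) ->
  {in `]a, b[, forall x, derivable g x 1} ->
  (@lebesgue_measure R).-integrable `]a, b[
    (fun x => (derive1 g x * Q x)%:E) ->
  exists2 l : R, g x @[x --> b^'-] --> l &
  (\int[lebesgue_measure]_(x in `]a, b[) ((l - g x) * derive1 Q x)%:E =
   \int[lebesgue_measure]_(x in `]a, b[) (derive1 g x * Q x)%:E)%E.
Proof.
move=> dQ Qmono Q0 [c cab Qc] dg igQ.
have q0 x : x \in `]a, b[ -> 0 <= derive1 Q x.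
  by move=> xab; exact: ndecr_derive1_ge0 Qmono xab (dQ _ xab).
have Qge0 x : x \in `]a, b[ -> 0 <= Q x by exact: ndecr_ge_at_right Q0.
have qQ x : x \in `]a, b[ -> derive1 Q x != 0 -> 0 < Q x.
  move=> xab; apply: contraNT; rewrite -leNgt => Qx.
  have Qx0 : Q x = 0 by apply/eqP; rewrite eq_le Qx Qge0.
  have ab : a <= b.
    by move: xab; rewrite in_itv/= => /andP[/lt_trans h /h /ltW].
  have [_] : is_derive x 1 Q 0.
    apply: (@derive1_at_min _ Q a b x) => //.
    by move=> t /Qge0; rewrite Qx0.
  by rewrite derive1E => ->.
have mg' : measurable_fun `]a, b[ (derive1 g).
  by apply: measurable_derive1 => //; exact: interval_open.
have mq : measurable_fun `]a, b[ (derive1 Q).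
  by apply: measurable_derive1 => //; exact: interval_open.
have ig' x : x \in `]a, b[ -> 0 < Q x ->
    (@lebesgue_measure R).-integrable `[x, b[ (EFin \o derive1 g).
  move=> xab Qx.
  have sub : `[x, b[ `<=` `]a, b[.
    by apply: subset_itvr; move: xab; rewrite in_itv/= bnd_simp => /andP[].
  have : (@lebesgue_measure R).-integrable `[x, b[
      (fun y => (Q x)^-1%:E * (derive1 g y * Q y)%:E)%E.
    by apply: integrableZl => //; exact: integrableS igQ.
  apply: le_integrable => //.
    apply/measurable_EFinP; exact: measurable_funS mg'.
  move=> y xy; rewrite /= lee_fin normrM normfV (gtr0_norm Qx).
  rewrite mulrC ler_pdivlMr// normrM ler_wpM2l// (ger0_norm (Qge0 _ (sub _ xy))).
  apply: (Qmono _ _ xab (sub _ xy)).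
  by move: xy; rewrite /= in_itv/= => /andP[].
have [l gl] : exists l : R, g x @[x --> b^'-] --> l.
  have c0 : 0 < Q c by rewrite lt_neqAle eq_sym Qc Qge0.
  eexists; apply: integral_derive1_co (ig' c cab c0).
    by move: cab; rewrite in_itv/= => /andP[].
  move=> x xcb; apply: dg; move: xcb cab; rewrite !in_itv/= => /andP[cx ->].
  by move=> /andP[ac _]; rewrite (lt_le_trans ac).
exists l => //.
have lE x : x \in `]a, b[ -> 0 < Q x ->
    (\int[lebesgue_measure]_(y in `[x, b[) (derive1 g y)%:E = (l - g x)%:E)%E.
  move=> xab Qx; have ig := ig' x xab Qx.
  have [ax xb] : a < x /\ x < b by move: xab; rewrite in_itv/= => /andP.
  have : g x @[x --> b^'-] --> g x + \int[lebesgue_measure]_(y in `[x, b[) derive1 g y.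
    apply: integral_derive1_co => // y; rewrite in_itv/= => /andP[xy yb].
    by apply: dg; rewrite in_itv/= (lt_le_trans ax).
  move=> /(cvg_unique _ gl) -> //; rewrite addrC addKr fineK//.
  exact: integrable_fin_num.
have QE x : x \in `]a, b[ ->
    (\int[lebesgue_measure]_(y in `]a, x]) (derive1 Q y)%:E = (Q x)%:E)%E.
  move=> xab.
  have [ax xb] : a < x /\ x < b by move: xab; rewrite in_itv/= => /andP.
  have sub : `]a, x] `<=` `]a, b[ by apply: subset_itvl; rewrite bnd_simp.
  rewrite (@ge0_integral_derive1_oc R Q a x 0) ?subr0//.
  - by move=> y /sub; exact: dQ.
  - exact: measurable_funS mq.
  - by move=> y /sub; exact: q0.
pose Rm := measurableTypeR R.
pose mu : {sigma_finite_measure set Rm -> \bar R} := @lebesgue_measure R.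
have mab : measurable (`]a, b[%classic : set Rm) by [].
(* Extended by zero, so that the kernel is measurable on the whole plane. *)
pose p : Rm -> R := derive1 Q \_ `]a, b[.
pose F : Rm -> R := derive1 g \_ `]a, b[.
have mp : measurable_fun setT p by apply/(measurable_restrictT _ mab).
have mF : measurable_fun setT F by apply/(measurable_restrictT _ mab).
pose k (z : Rm * Rm) : \bar R :=
  (if (z.1 : R) <= z.2 then p z.1 * F z.2 else 0)%:E.
have mid : measurable_fun setT (fun x : Rm => x : R).
  by move=> _ A mA; rewrite setTI; exact: mA.
have mk : measurable_fun setT k.
  apply/measurable_EFinP; apply: measurable_fun_ifT => //.
    apply: measurable_fun_ler.
      exact: (measurableT_comp mid measurable_fst).
    exact: (measurableT_comp mid measurable_snd).
  apply: measurable_funM.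
    exact: (measurableT_comp mp measurable_fst).
  exact: (measurableT_comp mF measurable_snd).
have intq t v : v \in `]a, b[ ->
    (\int[mu]_u (if (u : R) <= v then p u * t else 0)%:E = (t * Q v)%:E)%E.
  move=> vab.
  have [av vb] : a < v /\ v < b by move: vab; rewrite in_itv/= => /andP.
  have sub : `]a, v] `<=` `]a, b[ by apply: subset_itvl; rewrite bnd_simp.
  transitivity (\int[mu]_(u in `]a, v]) (t%:E * (derive1 Q u)%:E))%E.
    rewrite [RHS]integral_mkcond; apply: eq_integral => u _; rewrite patchE.
    have [/set_mem uv|/negP uv] := boolP (u \in `]a, v]%classic).
      have := uv; rewrite /= in_itv/= => /andP[_ ->].
      by rewrite /p patchE (mem_set (sub _ uv)) mulrC EFinM.
    case: ifPn => // uv'; rewrite /p patchE memNset ?mul0r// => uab.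
    apply: uv; rewrite inE/= in_itv/= uv' andbT.
    by move: uab; rewrite /= in_itv/= => /andP[].
  rewrite integralZl//; first by rewrite [X in (_ * X)%E](QE v vab).
  apply/integrableP; split.
    by apply/measurable_EFinP; exact: measurable_funS mq.
  under eq_integral => u uv.
    rewrite /= ger0_norm; last by apply: q0; move: uv; rewrite inE => /sub.
    over.
  by rewrite [ltLHS](QE v vab) ltry.
have int_u v : (\int[mu]_u k (u, v) =
    ((fun x => (derive1 g x * Q x)%:E) \_ `]a, b[) v)%E.
  rewrite patchE; case: ifPn => [/set_mem vab|/negP vab].
    by rewrite [LHS](intq (F v) v vab) /F patchE mem_set.
  apply: integral0_eq => u _; rewrite /k/= /F patchE memNset; last first.
    by move=> h; apply: vab; rewrite inE.
  by rewrite mulr0 if_same.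
have int_abs_u v : (\int[mu]_u `|k (u, v)| =
    ((fun x => `|(derive1 g x * Q x)%:E|) \_ `]a, b[) v)%E.
  transitivity (\int[mu]_u (if (u : R) <= v then p u * `|F v| else 0)%:E)%E.
    apply: eq_integral => u _; rewrite /k/=.
    case: ifPn => _; last by rewrite normr0.
    rewrite normrM ger0_norm// /p patchE; case: ifPn => // /set_mem.
    exact: q0.
  rewrite patchE; case: ifPn => [/set_mem vab|/negP vab].
    rewrite [LHS](intq `|F v| v vab) /F patchE mem_set//= normrM.
    by rewrite (ger0_norm (Qge0 _ vab)).
  apply: integral0_eq => u _; rewrite /F patchE memNset; last first.
    by move=> h; apply: vab; rewrite inE.
  by rewrite normr0 mulr0 if_same.
have int_v u : (\int[mu]_v k (u, v) =
    ((fun x => ((l - g x) * derive1 Q x)%:E) \_ `]a, b[) u)%E.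
  rewrite patchE; case: ifPn => [/set_mem uab|/negP uab]; last first.
    apply: integral0_eq => v _; rewrite /k/= /p patchE memNset; last first.
      by move=> h; apply: uab; rewrite inE.
    by rewrite mul0r if_same.
  have [qu0|qu0] := eqVneq (derive1 Q u) 0.
    rewrite qu0 mulr0; apply: integral0_eq => v _.
    by rewrite /k/= /p patchE mem_set// qu0 mul0r if_same.
  have Qu := qQ u uab qu0.
  have [au ub] : a < u /\ u < b by move: uab; rewrite /= in_itv/= => /andP.
  have sub : `[u, b[ `<=` `]a, b[ by apply: subset_itvr; rewrite bnd_simp.
  transitivity (\int[mu]_(v in `[u, b[) ((derive1 Q u)%:E * (derive1 g v)%:E))%E.
    rewrite [RHS]integral_mkcond; apply: eq_integral => v _; rewrite patchE.
    rewrite /k/= /p patchE (mem_set uab).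
    case: ifPn => [uv|uv].
      rewrite /F !patchE; case: ifPn => [/set_mem vab|/negP vab].
        rewrite mem_set// /= in_itv/= uv.
        by move: vab; rewrite /= in_itv/= => /andP[].
      by rewrite memNset ?mulr0// => /sub h; apply: vab; rewrite inE.
    rewrite memNset// /= in_itv/= => /andP[uv' _].
    by rewrite uv' in uv.
  rewrite integralZl//; last exact: ig'.
  by rewrite [X in (_ * X)%E](lE u uab Qu) -EFinM mulrC.
have ik : (mu \x mu)%E.-integrable setT k.
  apply/integrable21ltyP => //; move/integrableP : igQ => [_].
  rewrite integral_mkcond; congr (_ < _)%E; apply: eq_integral => v _.
  by rewrite int_abs_u.
transitivity (\int[mu]_u \int[mu]_v k (u, v))%E.
  by rewrite [LHS]integral_mkcond; apply: eq_integral => u _; rewrite int_v.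
rewrite (Fubini ik) [RHS]integral_mkcond.
by apply: eq_integral => v _; rewrite int_u.
Qed.

(** * Expectations of functions of a variable with a density *)

Import HBNNSimple.

(** The functions are not assumed measurable: the integral is a difference of
    suprema over simple functions, and a simple function below [f] may be
    replaced by zero on [N] without changing its integral. *)
Lemma eq_integral_null d (T : measurableType d) (R : realType)
    (mu : {measure set T -> \bar R}) (N : set T) (f g : T -> \bar R) :
  measurable N -> mu N = 0%E -> {in ~` N, f =1 g} ->
  (\int[mu]_x f x = \int[mu]_x g x)%E.
Proof.
move=> mN muN0.
have le_int (u v : T -> \bar R) : (forall x, 0 <= u x)%E ->
    (forall x, 0 <= v x)%E -> {in ~` N, u =1 v} ->
    (\int[mu]_x u x <= \int[mu]_x v x)%E.
  move=> u0 v0 uv; rewrite ge0_integralTE// ge0_integralTE//.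
  apply: ge_ereal_sup => _ /= [h hu <-].
  have mNc := measurableC mN.
  have -> : sintegral mu h = sintegral mu (proj_nnsfun h mNc).
    rewrite -mrestrict -integral_nnsfun//.
    have -> : sintegral mu h = (\int[mu]_x (h x)%:E)%E.
      by rewrite integral_nnsfun// patch_setT.
    rewrite (ge0_negligible_integral mN)// ?setTD//.
    - exact/measurable_EFinP.
    - by move=> x _; rewrite lee_fin.
  apply: ereal_sup_ubound; exists (proj_nnsfun h mNc) => //= x.
  rewrite mindicE; have [xN|xN] := boolP (x \in ~` N).
    by rewrite mulr1 -uv.
  by rewrite mulr0.
move=> fg.
have eq_int (u v : T -> \bar R) : (forall x, 0 <= u x)%E ->
    (forall x, 0 <= v x)%E -> {in ~` N, u =1 v} ->
    (\int[mu]_x u x = \int[mu]_x v x)%E.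
  move=> u0 v0 uv; apply/eqP; rewrite eq_le !le_int// => x xN.
  by rewrite uv.
rewrite integralE [RHS]integralE; congr (_ - _)%E; apply: eq_int => //.
- by move=> x xN; rewrite !funeposE fg.
- by move=> x xN; rewrite !funenegE fg.
Qed.

(** For nonnegative integrands this is the change of variables for the
    Radon-Nikodym derivative of the law of [V], which is almost everywhere the
    density; the general case follows by splitting into positive and negative
    parts, without any integrability.  Outside [D], where [V] almost never
    lies, [h] is arbitrary. *)
Lemma expectation_density d (T : measurableType d) (R : realType)
    (P : probability T R) (V : {RV P >-> R}) (D : set R) (p h : R -> R) :
  measurable D -> measurable_fun D p -> (forall x, D x -> 0 <= p x) ->
  has_density V (p \_ D) -> measurable_fun D h ->
  ('E_P[h \o V] = \int[lebesgue_measure]_(x in D) (h x * p x)%:E)%E.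
Proof.
move=> mD mp p0 Vp mh.
(* Lebesgue measure lives on the sigma-algebra generated by the half-open
   intervals; [V'] is [V] seen as a variable with values there. *)
pose Rm := measurableTypeR R.
pose mu : {sigma_finite_measure set Rm -> \bar R} := @lebesgue_measure R.
have mV : measurable_fun setT (V : T -> Rm).
  by move=> _ A mA; rewrite setTI; exact: (measurable_funPTI V).
pose V' : {mfun T >-> Rm} :=
  HB.pack (V : T -> Rm) (isMeasurableFun.Build _ _ _ _ (V : T -> Rm) mV).
have V'p (A : set Rm) : measurable A ->
  distribution P V' A = (\int[mu]_(x in A) ((p \_ D) x)%:E)%E by exact: Vp.
have mD' : measurable (D : set Rm) by [].
have mpD : measurable_fun setT (p \_ D : Rm -> R).
  by apply/(measurable_restrictT _ mD').
have pD0 x : 0 <= (p \_ D) x.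
  by rewrite patchE; case: ifPn => // /set_mem; exact: p0.
have VD : distribution P V' (~` D) = 0%E.
  rewrite V'p; last exact: measurableC.
  by apply: integral0_eq => x Dx; rewrite patchE memNset.
have dom : distribution P V' `<< mu.
  apply/null_content_dominatesP => A mA A0; rewrite V'p//.
  apply: null_set_integral => //.
  by apply/measurable_EFinP; exact: measurable_funTS.
have ipD : mu.-integrable setT (EFin \o p \_ D : Rm -> _).
  apply/integrableP; split; first exact/measurable_EFinP.
  under eq_integral do rewrite /= ger0_norm//.
  by rewrite -V'p// probability_setT ltry.
have ge0_transfer (phi : Rm -> \bar R) : measurable_fun setT phi ->
    (forall x, 0 <= phi x)%E ->
    (\int[P]_w phi (V w) = \int[mu]_x (phi x * ((p \_ D) x)%:E))%E.
  move=> mphi phi0.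
  transitivity (\int[distribution P V']_y phi y)%E.
    by rewrite ge0_integral_pushforward.
  rewrite -(Radon_Nikodym_SigmaFinite.change_of_variables dom)//.
  apply: ae_eq_integral => //.
  - apply: emeasurable_funM => //.
    exact/measurable_int/Radon_Nikodym_SigmaFinite.f_integrable.
  - by apply: emeasurable_funM => //; exact/measurable_EFinP.
  - apply: ae_eqe_mul2l; apply: integral_ae_eq => //.
    + exact: Radon_Nikodym_SigmaFinite.f_integrable.
    + exact/measurable_EFinP.
    + by move=> A _ mA; rewrite -Radon_Nikodym_SigmaFinite.f_integral//; exact: V'p.
pose H : Rm -> \bar R := EFin \o h \_ D.
have mH : measurable_fun setT H.
  by apply/measurable_EFinP/(measurable_restrictT _ mD').
rewrite unlock.
rewrite (@eq_integral_null _ _ _ P (V @^-1` (~` D)) _ (H \o V)); first last.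
- move=> w; rewrite inE/= => /contrapT DVw.
  by rewrite /H/= patchE mem_set.
- exact: VD.
- exact: (measurable_funPTI V' (measurableC mD')).
rewrite integralE.
under eq_integral do rewrite funepos_comp/=.
under [X in (_ - X)%E]eq_integral do rewrite funeneg_comp/=.
rewrite !ge0_transfer//; last 2 first.
  exact: measurable_funeneg.
  exact: measurable_funepos.
rewrite [RHS]integral_mkcond [RHS]integralE; congr (_ - _)%E.
- apply: eq_integral => x _; rewrite !funeposE /H /= !patchE.
  case: ifPn => [/set_mem Dx|_]; last by rewrite mule0 maxxx.
  by rewrite -!EFin_max -EFinM maxr_pMl ?p0// mul0r.
- apply: eq_integral => x _; rewrite !funenegE /H /= !patchE.
  case: ifPn => [/set_mem Dx|_]; last by rewrite mule0 oppe0 maxxx.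
  by rewrite -!EFinN -!EFin_max -EFinM maxr_pMl ?p0// mul0r mulNr.
Qed.

(** * Quantile functions and the identity *)

(** The limits of the distribution function at infinity make the sets in the
    definition of the quantile nonempty and bounded below, so that infima are
    monotone for inclusion. *)
Lemma quantile_ndecr d (T : measurableType d) (R : realType)
    (P : probability T R) (X : {RV P >-> R}) :
  {in `]0, 1[ &, {homo quantile X : u v / u <= v}}.
Proof.
move=> u v; rewrite !in_itv/= => /andP[u0 _] /andP[_ v1] uv.
apply: lb_le_inf.
  apply: contrapT => h; have : (1 <= v%:E)%E.
    apply: (cvge_to_le (cvg_cdfy1 X)); apply: nearW => x.
    by rewrite leNgt; apply/negP => /ltW vx; apply: h; exists x.
  by rewrite lee_fin leNgt v1.
move=> x /= vx; apply: ge_inf; last by rewrite /= (le_trans _ vx)// lee_fin.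
have [y yu] : exists y, (cdf X y < u%:E)%E.
  apply: contrapT => h; have : (u%:E <= 0)%E.
    apply: (cvge_to_ge (cvg_cdfNy0 X)); apply: nearW => y.
    by rewrite leNgt; apply/negP => yu; apply: h; exists y.
  by rewrite lee_fin leNgt u0.
exists y => z /= uz; rewrite leNgt; apply/negP => /ltW/(cdf_nondecreasing X) zy.
by move: (lt_le_trans (le_lt_trans zy yu) uz); rewrite ltxx.
Qed.

(** The uniform law is given by a density on the closed interval; the end
    points form a null set. *)
Lemma uniform01_density d (T : measurableType d) (R : realType)
    (P : probability T R) (U : {RV P >-> R}) :
  uniform01 U -> has_density U ((cst 1 : R -> R) \_ `]0, 1[).
Proof.
move=> Uu A mA; rewrite Uu// /uniform_prob.
set mu := @lebesgue_measure R.
apply: ae_eq_integral => //.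
- by apply/measurable_EFinP; apply: measurable_funTS; exact: measurable_uniform_pdf.
- apply/measurable_EFinP; apply: measurable_funTS.
  by apply/(measurable_restrictT _ (measurable_itv _)); exact: measurable_cst.
- exists [set 0; 1]; split.
  + by apply: measurableU; exact: measurable_set1.
  + apply: countable_lebesgue_measure0; apply: finite_set_countable.
    exact: finite_set2.
  + move=> x /= h; apply: contrapT => x01; apply: h => _.
    rewrite /uniform_pdf patchE subr0 invr1.
    case: ifPn => [/andP[x0 x1]|nx]; last first.
      by rewrite memNset// /= in_itv/= => /andP[x0 x1]; rewrite !ltW in nx.
    rewrite mem_set//= in_itv/= !lt_neqAle x0 x1 !andbT eq_sym.
    by apply/andP; split; apply/eqP => e; apply: x01; [left|right].
Qed.

Theorem theorem1 (R : realType)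
    (d : measure_display) (T : measurableType d) (P : probability T R)
    (X : {RV P >-> R})
    (dU : measure_display) (TU : measurableType dU) (PU : probability TU R)
    (U : {RV PU >-> R})
    (dL : measure_display) (TL : measurableType dL) (PL : probability TL R)
    (XL : {RV PL >-> R})
    (g : R -> R) :
  calD X ->
  (forall u : R, 0 < u < 1 -> derivable g u 1) ->
  (@lebesgue_measure R).-integrable `]0, 1[
    (fun u : R => (derive1 g u * quantile X u)%:E) ->
  uniform01 U ->
  lorenz_rv X XL ->
  cvg (g u @[u --> 1^'-]) /\
  ('E_PU[fun w => ((at_one g - g (U w)) * quantile_density X (U w))%R] =
   'E_PL[fun w => derive1 g (XL w)] * 'E_P[X])%E.
Proof.
move=> [_ iX Q0 dQ'] dg' igQ /uniform01_density Ud [_ _ XLd].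
set Q := quantile X in igQ Q0 dQ' XLd *.
set m := fine _ in XLd.
have EX : 'E_P[X]%E = m%:E.
  by rewrite /m fineK// expectation_fin_num//; apply/Lfun1_integrable.
have dQ : {in `]0, 1[, forall u, derivable Q u 1}.
  by move=> u; rewrite in_itv; exact: dQ'.
have dg : {in `]0, 1[, forall u, derivable g u 1}.
  by move=> u; rewrite in_itv; exact: dg'.
have Qmono : {in `]0, 1[ &, {homo Q : u v / u <= v}} by exact: quantile_ndecr.
have Qge0 u : u \in `]0, 1[ -> 0 <= Q u by exact: ndecr_ge_at_right Q0.
have mass1 : (\int[lebesgue_measure]_(u in `]0%R, 1%R[) (Q u / m)%:E = 1)%E.
  have := XLd setT measurableT; rewrite probability_setT => ->.
  rewrite integral_mkcond; apply: eq_integral => u _.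
  by rewrite !patchE; case: ifP.
have m0 : 0 < m.
  rewrite ltNge; apply/negP => mle0.
  have : (\int[lebesgue_measure]_(u in `]0%R, 1%R[) (Q u / m)%:E <= 0)%E.
    rewrite integralE (eq_integral (cst 0%E)) ?integral0 ?sub0e ?oppe_le0.
      exact: integral_ge0.
    apply: le0_funeposE => u u01.
    by rewrite lee_fin mulr_ge0_le0 ?invr_le0// Qge0.
  by rewrite mass1 lee_fin ler10.
have Qn0 : exists2 u, u \in `]0, 1[ & Q u != 0.
  apply: contrapT => Q00.
  suff : (\int[lebesgue_measure]_(u in `]0%R, 1%R[) (Q u / m)%:E = 0)%E.
    by rewrite mass1 => /eqP; rewrite eqe oner_eq0.
  apply: integral0_eq => u u01; have [->|Qu] := eqVneq (Q u) 0.
    by rewrite mul0r.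
  by exfalso; apply: Q00; exists u.
have o01 : open (`]0, 1[%classic : set R) by exact: interval_open.
have mQ : measurable_fun (`]0, 1[%classic : set R) Q by exact: derivable_measurable.
have mg : measurable_fun (`]0, 1[%classic : set R) g by exact: derivable_measurable.
have mg' : measurable_fun (`]0, 1[%classic : set R) (derive1 g) by exact: measurable_derive1.
have mq : measurable_fun (`]0, 1[%classic : set R) (derive1 Q) by exact: measurable_derive1.
have [l gl parts] := integral_by_parts_ndecr dQ Qmono Q0 Qn0 dg igQ.
split; first by apply/cvg_ex; exists l.
have g1 : at_one g = l by exact: cvg_lim.
rewrite g1 EX.
rewrite (expectation_density (h := fun u => (l - g u) * derive1 Q u) _ _ _ Ud)//; last first.
  by apply: measurable_funM => //; exact: measurable_funB.
rewrite (expectation_density (h := derive1 g) _ _ _ XLd)//; last 2 first.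
  exact: measurable_funM.
  by move=> u u01; rewrite divr_ge0 ?(ltW m0)// Qge0.
under eq_integral do rewrite mulr1.
rewrite parts.
have -> : (\int[lebesgue_measure]_(x in `]0%R, 1%R[) (derive1 g x * (Q x / m))%:E =
  m^-1%:E * \int[lebesgue_measure]_(x in `]0%R, 1%R[) (derive1 g x * Q x)%:E)%E.
  rewrite -integralZl//; apply: eq_integral => x _.
  by rewrite -EFinM mulrA mulrC.
by rewrite muleAC -EFinM mulVf ?mul1e// gt_eqF.
Qed.
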